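(* Let $\nu = 3/2$ and let $$u(x,y) = \int_0^\infty \frac{\cos k(x-\pi) + \cos k(x+\pi)}{k-\nu}\, e^{ky}\,dk .$$ Then the sloshing eigenfunction $u$ in the fluid domain $W_{3/2}$ has an interior high spot on the free surface $F_{3/2} = \{(x,0) : 0 < x < x_0\}$; that is, there exists $x_h \in (0,x_0)$ such that the restriction of the trace $x \mapsto u(x,0)$ to $[0,x_0]$ attains an extremum (its maximum or minimum value over $[0,x_0]$) at $x = x_h$. (Here $x_0$, $F_{3/2}$ and $W_{3/2}$ are as defined in the context.)
   Context: Put $\nu = 3/2$ and $\mathbb{R}^2_- = \{(x,y)\in\mathbb{R}^2 : y<0\}$. Consider $$u(x,y) = \int_0^\infty \frac{\cos k(x-\pi) + \cos k(x+\pi)}{k-\nu}\, e^{ky}\,dk, \qquad v(x,y) = \int_0^\infty \frac{\sin k(x-\pi) + \sin k(x+\pi)}{\nu-k}\, e^{ky}\,dk .$$ Since $\nu = 3/2$, both numerators vanish at $k=\nu$, so the integrals are usual convergent improper integrals. The functions $u$ and $v$ are conjugate harmonic functions in $\mathbb{R}^2_-$, with $u(-x,y)=u(x,y)$ and $v(-x,y)=-v(x,y)$; they are infinitely smooth up to $\{y=0\}\setminus\{(\pm\pi,0)\}$, and $u_y = \nu u$ holds on $\{y=0\}\setminus\{(\pm\pi,0)\}$. Known fact used to define the domain: besides the half-line $\{x=0,\ y<0\}$, there is exactly one nodal line of $v$ (connected curve on which $v=0$) in $\mathbb{R}^2_-$; it is smooth, symmetric about the $y$-axis, and both of its ends are on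 the $x$-axis; its right end is denoted $(x_0,0)$ and satisfies $0<x_0<\pi$. Fluid domain: $W_{3/2}$ is the bounded domain in $\{x>0,\ y<0\}$ enclosed by the right half ($x\ge 0$) of this curvilinear nodal line, the segment of the $y$-axis between the origin and the point where the curvilinear nodal line meets the negative $y$-axis, and the interval $F_{3/2} = \{(x,0): 0<x<x_0\}$ of the $x$-axis. The interval $F_{3/2}$ is the free surface and $B_{3/2} = \partial W_{3/2}\setminus \overline{F_{3/2}}$ is the bottom. Sloshing problem in a domain $W$ with free surface $F$ and bottom $B$: a sloshing eigenfunction with eigenvalue $\nu>0$ is a nontrivial $u$ with $u_{xx}+u_{yy}=0$ in $W$, $u_y=\nu u$ on $F$, $\partial u/\partial n=0$ on $B$, and $\int_F u\,dx=0$. The function $u$ above, restricted to $W_{3/2}$, is a sloshing eigenfunction with eigenvalue $\nu=3/2$ (the harmonic conjugate $v$ vanishes on $B_{3/2}$). High spot of $u$: a point $(x,0)\in\overline{F}$ at which the trace $u(\cdot,0)$, considered on $\overline{F}$, attains an extremum (maximum or minimum); it is an interior high spot if it belongs to the open interval $F$. *)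

(* Defs.v *)
From Stdlib Require Import Reals.
From Coquelicot Require Import Coquelicot.
Open Scope R_scope.

Definition nu : R := 3 / 2.

(* Both numerators vanish at [k = nu], where Rocq's total division gives the
   integrands a finite value; being the value at a single point, it does not
   affect the Riemann integrals.  For [y = 0] the integrals are only
   conditionally convergent; [u x 0] is the trace of [u] on the x-axis. *)
Definition u (x y : R) : R :=
  RInt_gen
    (fun k => (cos (k * (x - PI)) + cos (k * (x + PI))) / (k - nu) * exp (k * y))
    (at_point 0) (Rbar_locally p_infty).

Definition v (x y : R) : R :=
  RInt_gen
    (fun k => (sin (k * (x - PI)) + sin (k * (x + PI))) / (nu - k) * exp (k * y))
    (at_point 0) (Rbar_locally p_infty).

Definition closure (A : R * R -> Prop) (p : R * R) : Prop :=
  forall P : R * R -> Prop, locally p P -> exists q, P q /\ A q.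

Definition boundary (A : R * R -> Prop) (p : R * R) : Prop :=
  closure A p /\ closure (fun q => ~ A q) p.

Definition connected (A : R * R -> Prop) : Prop :=
  forall U V : R * R -> Prop,
    open U -> open V ->
    (forall p, A p -> U p \/ V p) ->
    (exists p, A p /\ U p) -> (exists p, A p /\ V p) ->
    exists p, A p /\ U p /\ V p.

Definition bounded (A : R * R -> Prop) : Prop :=
  exists M, forall p, A p -> Rabs (fst p) <= M /\ Rabs (snd p) <= M.

(* The points of the open arc parametrized by [gam] over (-1, 1). *)
Definition arc (gam : R -> R * R) (p : R * R) : Prop :=
  exists t, -1 < t < 1 /\ gam t = p.

(* [gam] parametrizes over (-1, 1) the nodal line of [v] other than the
   half-line {x = 0, y < 0}, with right end (x0, 0).  By [nodal_zeros] the zero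
   set of [v] in the lower half-plane consists of exactly these two lines, which
   cross on the y-axis; so the arc is determined by [v], and only its
   parametrization is free. *)
Record nodal_line (gam : R -> R * R) (x0 : R) : Prop := {
  nodal_smooth : forall (n : nat) (t : R), -1 < t < 1 ->
    ex_derive_n (fun s => fst (gam s)) n t /\
    ex_derive_n (fun s => snd (gam s)) n t;
  nodal_regular : forall t, -1 < t < 1 ->
    Derive (fun s => fst (gam s)) t <> 0 \/
    Derive (fun s => snd (gam s)) t <> 0;
  nodal_simple : forall s t, -1 < s < 1 -> -1 < t < 1 -> gam s = gam t -> s = t;
  nodal_lower : forall p, arc gam p -> snd p < 0;
  nodal_zeros : forall x y, y < 0 -> (v x y = 0 <-> x = 0 \/ arc gam (x, y));
  nodal_symmetric : forall x y, arc gam (x, y) -> arc gam (- x, y);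
  nodal_left_end : filterlim gam (at_right (-1)) (locally (- x0, 0));
  nodal_right_end : filterlim gam (at_left 1) (locally (x0, 0));
  nodal_end_range : 0 < x0 < PI
}.

Definition free_surface (x0 : R) (p : R * R) : Prop :=
  0 < fst p < x0 /\ snd p = 0.

(* The segment of the y-axis from the origin down to the arc. *)
Definition axis_segment (gam : R -> R * R) (p : R * R) : Prop :=
  fst p = 0 /\ exists b, arc gam (0, b) /\ b <= snd p <= 0.

(* [W] is the bounded domain enclosed by the Jordan curve made of the right half
   of the arc, the axis segment and the closed free surface; by the Jordan curve
   theorem these properties determine [W]. *)
Record fluid_domain (gam : R -> R * R) (x0 : R) (W : R * R -> Prop) : Prop := {
  fluid_open : open W;
  fluid_connected : connected W;
  fluid_bounded : bounded W;
  fluid_quadrant : forall p, W p -> 0 < fst p /\ snd p < 0;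
  fluid_boundary : forall p, boundary W p <->
    (arc gam p /\ 0 <= fst p) \/ axis_segment gam p \/ closure (free_surface x0) p
}.

Definition high_spot (F : R * R -> Prop) (f : R -> R -> R) (p : R * R) : Prop :=
  closure F p /\
  ((forall q, closure F q -> f (fst q) (snd q) <= f (fst p) (snd p)) \/
   (forall q, closure F q -> f (fst p) (snd p) <= f (fst q) (snd q))).

Definition interior_high_spot (F : R * R -> Prop) (f : R -> R -> R) (p : R * R) :
  Prop := F p /\ high_spot F f p.

(* Main.v *)
(* With [a = PI - x], [b = PI + x], [t = k - nu], the integrands at [y = 0] are
   combinations of [(sin at + sin bt) / t] and [(cos at - cos bt) / t] with
   coefficients [cos (nu x)], [sin (nu x)], so the traces on the x-axis are
   explicit in terms of Si, Cin and ln, and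
     v_x = - nu u,    u_x = nu v + 1/a - 1/b,    v(0,0) = 0,    u(0,0) > 0.
   By Abel's test the tails of the integral for [v] are small uniformly up to
   [y = 0], hence [v] is continuous at [(x0, 0)] and vanishes there.  So
   [u_x (x0, 0) > 0], and the minimum of [u(., 0)] over [[0, x0]] is not at [x0];
   it is not at [0] either, since then [u >= u(0,0) > 0] would make [v] strictly
   decreasing, contradicting [v(0,0) = v(x0,0) = 0]. *)
Require Import Defs.
From Stdlib Require Import Reals Lra.
From Coquelicot Require Import Coquelicot.
Open Scope R_scope.

(** * Comparison of functions through their derivatives *)

Lemma nondecreasing_of_deriv (f df : R -> R) (s t : R) :
  s <= t -> (forall x, s <= x <= t -> is_derive f x (df x)) ->
  (forall x, s <= x <= t -> 0 <= df x) -> f s <= f t.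
Proof.
intros st Hf Hdf.
destruct (MVT_gen f s t df) as [c [Hc E]].
- rewrite Rmin_left, Rmax_right by lra. intros x Hx; apply Hf; lra.
- rewrite Rmin_left, Rmax_right by lra. intros x Hx.
  apply continuity_pt_filterlim, (ex_derive_continuous f).
  exists (df x); apply Hf; lra.
- rewrite Rmin_left, Rmax_right in Hc by lra.
  specialize (Hdf c Hc). nra.
Qed.

(** Both [g - f] and [g + f] have nonnegative derivatives. Most estimates below use this with an
    explicit [g] in place of bounding an integral. *)
Lemma increment_bound (f df g dg : R -> R) (s t : R) :
  s <= t ->
  (forall x, s <= x <= t -> is_derive f x (df x)) ->
  (forall x, s <= x <= t -> is_derive g x (dg x)) ->
  (forall x, s <= x <= t -> Rabs (df x) <= dg x) ->
  Rabs (f t - f s) <= g t - g s.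
Proof.
intros st Hf Hg Hb.
assert (H1 : g s - f s <= g t - f t).
{ apply (nondecreasing_of_deriv (fun x => g x - f x) (fun x => dg x - df x)); trivial.
  - intros x Hx. apply (is_derive_minus g f); auto.
  - intros x Hx. generalize (Hb x Hx) (Rle_abs (df x)); lra. }
assert (H2 : g s + f s <= g t + f t).
{ apply (nondecreasing_of_deriv (fun x => g x + f x) (fun x => dg x + df x)); trivial.
  - intros x Hx. apply (is_derive_plus g f); auto.
  - intros x Hx. generalize (Hb x Hx) (Rle_abs (- df x)). rewrite Rabs_Ropp; lra. }
apply Rabs_le; lra.
Qed.

Lemma is_derive_primitive (f : R -> R) (a s : R) :
  (forall x, continuous f x) -> is_derive (fun t => RInt f a t) s (f s).
Proof.
intros Hf. apply (is_derive_RInt f (fun t => RInt f a t) a s); [|apply Hf].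
apply filter_forall. intros t. apply (@RInt_correct R_CompleteNormedModule).
apply (@ex_RInt_continuous R_CompleteNormedModule); auto.
Qed.

Lemma abs_sin_le (x : R) : Rabs (sin x) <= Rabs x.
Proof.
assert (H : forall z, 0 <= z -> Rabs (sin z - sin 0) <= z - 0).
{ intros z Hz. apply (increment_bound sin cos (fun t => t) (fun _ => 1)); trivial.
  - intros; apply is_derive_sin.
  - intros; apply (@is_derive_id R_AbsRing).
  - intros; apply Rabs_le; generalize (COS_bound x0); lra. }
rewrite sin_0 in H.
destruct (Rle_dec 0 x) as [Hx|Hx].
- rewrite (Rabs_pos_eq x Hx). generalize (H x Hx). rewrite !Rminus_0_r; trivial.
- rewrite (Rabs_left x) by lra. generalize (H (-x) ltac:(lra)).
  rewrite sin_neg, !Rminus_0_r, Rabs_Ropp; trivial.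
Qed.

(** * Sine and cosine integrals *)

(** The case split is needed for continuity: total division would give [sin 0 / 0 = 0]. *)
Definition sinc (t : R) : R := if Req_EM_T t 0 then 1 else sin t / t.

(* At [t = 0] this is [0 / 0 = 0], which is also the continuous value. *)
Definition cosc (t : R) : R := (1 - cos t) / t.

Lemma sinc_neq0 (t : R) : t <> 0 -> sinc t = sin t / t.
Proof. intros; unfold sinc; destruct Req_EM_T; tauto. Qed.

Lemma continuous_sinc (x : R) : continuous sinc x.
Proof.
destruct (Req_dec x 0) as [->|Hx].
- apply continuity_pt_filterlim. intros eps Heps.
  destruct (derivable_pt_lim_sin_0 eps Heps) as [d Hd].
  exists d; split; [apply cond_pos|].
  intros t [[_ Ht] Htd]. unfold dist, R_met, R_dist in *; simpl in *. 
  unfold R_dist in *; rewrite Rminus_0_r in Htd.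
  assert (t <> 0) by auto.
  rewrite (sinc_neq0 t H). unfold sinc; destruct Req_EM_T; [|tauto].
  specialize (Hd t H Htd). rewrite Rplus_0_l, sin_0, Rminus_0_r in Hd. exact Hd.
- apply continuous_ext_loc with (fun t => sin t / t).
  + assert (Hp : 0 < Rabs x) by (apply Rabs_pos_lt; trivial).
    exists (mkposreal _ Hp). intros t Ht. symmetry; apply sinc_neq0.
    intros ->. unfold ball in Ht; simpl in Ht; unfold AbsRing_ball, abs, minus, plus, opp in Ht; simpl in Ht.
    rewrite Rplus_0_l, Rabs_Ropp in Ht; lra.
  + apply (ex_derive_continuous (fun t => sin t / t)). auto_derive; trivial.
Qed.

(** By the half-angle formula [cosc t] is [sin (t / 2)] times [sin (t / 2) / (t / 2)], and
    [|sin z| <= |z|] bounds both factors. This yields continuity of [cosc] at 0. *)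
Lemma abs_cosc_le (t : R) : Rabs (cosc t) <= Rabs t.
Proof.
unfold cosc. destruct (Req_dec t 0) as [->|Ht].
- rewrite cos_0. unfold Rdiv. rewrite Rminus_diag, Rmult_0_l. lra.
- replace t with (2 * (t / 2)) at 1 by field.
  rewrite cos_2a_sin.
  replace ((1 - (1 - 2 * sin (t / 2) * sin (t / 2))) / t)
    with (sin (t / 2) * (sin (t / 2) / (t / 2))) by (field; trivial).
  assert (Hh : 0 < Rabs (t / 2)) by (apply Rabs_pos_lt; lra).
  generalize (abs_sin_le (t / 2)) (Rabs_pos (sin (t / 2))). intros H1 H0.
  rewrite Rabs_mult, Rabs_div by lra.
  assert (Rabs (sin (t / 2)) / Rabs (t / 2) <= 1).
  { apply Rmult_le_reg_r with (Rabs (t / 2)); trivial.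
    unfold Rdiv at 1; rewrite Rmult_assoc, Rinv_l; lra. }
  replace (Rabs t) with (2 * Rabs (t / 2)).
  2:{ rewrite <- (Rabs_pos_eq 2) at 1 by lra. rewrite <- Rabs_mult. f_equal; field. }
  assert (0 <= Rabs (sin (t / 2)) / Rabs (t / 2)).
  { apply Rmult_le_pos; trivial. left; apply Rinv_0_lt_compat; trivial. }
  nra.
Qed.

Lemma continuous_cosc (x : R) : continuous cosc x.
Proof.
destruct (Req_dec x 0) as [->|Hx].
- apply continuity_pt_filterlim. intros eps Heps.
  exists eps; split; [trivial|].
  intros t [_ Ht]. simpl in *. unfold R_dist in *.
  replace (cosc 0) with 0 by (unfold cosc; rewrite cos_0; unfold Rdiv; ring).
  rewrite Rminus_0_r in *. eapply Rle_lt_trans; [apply abs_cosc_le|trivial].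
- apply (ex_derive_continuous cosc). unfold cosc. auto_derive; trivial.
Qed.

Definition Si (t : R) : R := RInt sinc 0 t.
(** The entire cosine integral: for [t > 0] it is Euler's constant plus [ln t - Ci t], but it is
    smooth across 0. *)
Definition Cin (t : R) : R := RInt cosc 0 t.

Lemma is_derive_Si (t : R) : is_derive Si t (sinc t).
Proof. apply is_derive_primitive, continuous_sinc. Qed.

Lemma is_derive_Cin (t : R) : is_derive Cin t (cosc t).
Proof. apply is_derive_primitive, continuous_cosc. Qed.

Lemma abs_opp_div_sqr_le (c t : R) : -1 <= c <= 1 -> 0 < t -> Rabs (- c / t ^ 2) <= 1 / t ^ 2.
Proof.
intros Hc Ht. assert (0 < / t ^ 2) by (apply Rinv_0_lt_compat, pow_lt; trivial).
unfold Rdiv. apply Rabs_le; split; nra.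
Qed.

Lemma is_derive_neg_inv (t : R) : 0 < t -> is_derive (fun t => - / t) t (1 / t ^ 2).
Proof. intros Ht. auto_derive; [lra|]. field; lra. Qed.

(** Integration by parts in disguise: [Si x + cos x / x] has derivative [- cos x / x ^ 2], dominated
    by that of [- / x]. Its increment is at most [/ s - / t], and the two cosine terms add at most
    [/ s + / t]. *)
Lemma Si_increment (s t : R) : 0 < s <= t -> Rabs (Si t - Si s) <= 2 / s.
Proof.
intros Hst.
assert (H : Rabs ((Si t + cos t / t) - (Si s + cos s / s)) <= - / t - - / s).
{ apply (increment_bound (fun x => Si x + cos x / x) (fun x => - cos x / x ^ 2)
    (fun x => - / x) (fun x => 1 / x ^ 2)); [lra| | |].
  - intros x Hx.
    replace (- cos x / x ^ 2) with (sinc x + (- sin x * x - cos x) / x ^ 2).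
    2:{ rewrite sinc_neq0 by lra. field; lra. }
    apply (is_derive_plus Si (fun x => cos x / x)); [apply is_derive_Si|].
    auto_derive; [lra|]. field; lra.
  - intros x Hx; apply is_derive_neg_inv; lra.
  - intros x Hx; apply abs_opp_div_sqr_le; [apply COS_bound|lra]. }
assert (0 < / t) by (apply Rinv_0_lt_compat; lra).
assert (0 < / s) by (apply Rinv_0_lt_compat; lra).
apply Rabs_le_between in H. apply Rabs_le. unfold Rdiv in *.
generalize (COS_bound t) (COS_bound s). intros. split; nra.
Qed.

(** Subtracting [ln] leaves the oscillating derivative [- cos x / x]; adding [sin x / x] then
    integrates by parts as for [Si]. *)
Lemma Cin_ln_increment (s t : R) :
  0 < s <= t -> Rabs ((Cin t - ln t) - (Cin s - ln s)) <= 2 / s.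
Proof.
intros Hst.
assert (H : Rabs ((Cin t - ln t + sin t / t) - (Cin s - ln s + sin s / s)) <= - / t - - / s).
{ apply (increment_bound (fun x => Cin x - ln x + sin x / x) (fun x => - sin x / x ^ 2)
    (fun x => - / x) (fun x => 1 / x ^ 2)); [lra| | |].
  - intros x Hx.
    replace (- sin x / x ^ 2) with (cosc x - / x + (cos x * x - sin x) / x ^ 2).
    2:{ unfold cosc. field; lra. }
    apply (is_derive_plus (fun x => Cin x - ln x) (fun x => sin x / x)).
    + apply (is_derive_minus Cin ln); [apply is_derive_Cin|apply is_derive_ln; lra].
    + auto_derive; [lra|]. field; lra.
  - intros x Hx; apply is_derive_neg_inv; lra.
  - intros x Hx; apply abs_opp_div_sqr_le; [apply SIN_bound|lra]. }
assert (0 < / t) by (apply Rinv_0_lt_compat; lra).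
assert (0 < / s) by (apply Rinv_0_lt_compat; lra).
apply Rabs_le_between in H. apply Rabs_le. unfold Rdiv in *.
generalize (SIN_bound t) (SIN_bound s). intros. split; nra.
Qed.

(** The bound gives the Cauchy property, and letting [t] tend to infinity in it gives the rate. *)
Lemma lim_of_increment_bound (F : R -> R) (C T : R) :
  0 <= C ->
  (forall s t, T < s -> s <= t -> Rabs (F t - F s) <= C / (s - T)) ->
  exists l, filterlim F (Rbar_locally p_infty) (locally l) /\
    forall s, T < s -> Rabs (F s - l) <= C / (s - T).
Proof.
intros HC H.
assert (HL : exists l, filterlim F (Rbar_locally p_infty) (locally l)).
{ apply (proj1 (@filterlim_locally_cauchy R R_CompleteSpace (Rbar_locally p_infty) _ F)).
  intros eps. set (M := T + C / eps + 1).
  assert (Hce : 0 <= C / eps) by (apply Rdiv_le_0_compat; [trivial|apply cond_pos]).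
  assert (W : forall s t, M < s -> s <= t -> Rabs (F t - F s) < eps).
  { intros s t Hs Hst. eapply Rle_lt_trans; [apply H; unfold M in Hs; lra|].
    assert (HsT : C / eps < s - T) by (unfold M in Hs; lra).
    apply Rmult_lt_reg_r with (s - T); [lra|].
    unfold Rdiv at 1; rewrite Rmult_assoc, Rinv_l, Rmult_1_r by lra.
    generalize (cond_pos eps); intros.
    apply Rmult_lt_compat_l with (r := eps) in HsT; [|trivial].
    replace (eps * (C / eps)) with C in HsT by (field; lra). lra. }
  exists (fun s => M < s). split; [exists M; auto|].
  intros s t Hs Ht. change (Rabs (F t - F s) < eps).
  destruct (Rle_dec s t); [apply W; lra|].
  rewrite Rabs_minus_sym. apply W; lra. }
destruct HL as [l Hl]. exists l; split; trivial.
intros s Hs. apply Rnot_lt_le. intros Hc.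
(* The supposed excess over the bound serves as tolerance: at a point beyond both [s] and [M], [F]
   is within [e] of [l], against the increment bound from [s]. *)
set (e := Rabs (F s - l) - C / (s - T)).
assert (He : 0 < e) by (unfold e; lra).
destruct (proj1 (@filterlim_locally _ R_UniformSpace _ _ F l) Hl (mkposreal e He)) as [M HM].
assert (Ht : M < Rmax (M + 1) s) by (generalize (Rmax_l (M + 1) s); lra).
specialize (HM _ Ht). change (Rabs (F (Rmax (M + 1) s) - l) < e) in HM.
generalize (H s (Rmax (M + 1) s) Hs (Rmax_r _ _)). intros H2.
generalize (Rabs_triang (F s - F (Rmax (M + 1) s)) (F (Rmax (M + 1) s) - l)).
replace (F s - F (Rmax (M + 1) s) + (F (Rmax (M + 1) s) - l)) with (F s - l) by ring.
rewrite (Rabs_minus_sym (F s) (F _)). unfold e in HM. lra.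
Qed.

(** Serves the sign of [Si] and, at [s = PI * nu] where the cosine vanishes, the strict positivity
    of [u] at the origin. *)
Lemma Si_lower (s : R) : 0 < s -> (1 - cos s) / s <= Si s.
Proof.
intros Hs. apply Rle_plus_epsilon. intros eps Heps.
(* [Si t - (1 - cos t) / t] is nondecreasing and vanishes at [0]. *)
set (h := fun t => Si t - cosc t).
assert (Hc : continuity_pt h 0).
{ apply continuity_pt_filterlim, (continuous_minus Si cosc 0); [|apply continuous_cosc].
  apply (ex_derive_continuous Si). eexists; apply is_derive_Si. }
destruct (Hc eps Heps) as [d [Hd Hh]].
(* The formula for the derivative of [h] needs a positive argument, so monotonicity is used from a
   small [t > 0], where continuity gives [|h t| < eps]. *)
set (t := Rmin (d / 2) s).
assert (Ht : 0 < t <= s) by (unfold t; split; [apply Rmin_glb_lt; lra|apply Rmin_r]).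
assert (Htd : t <= d / 2) by apply Rmin_l.
assert (H0 : h 0 = 0).
{ unfold h, Si, cosc. rewrite RInt_point, cos_0. unfold zero; simpl. unfold Rdiv; ring. }
specialize (Hh t). simpl in Hh. unfold R_dist in Hh. rewrite H0, !Rminus_0_r in Hh.
assert (Rabs (h t) < eps).
{ apply Hh. split; [split; [exact I|lra]|]. rewrite Rabs_pos_eq; lra. }
assert (h t <= h s).
{ apply (nondecreasing_of_deriv h (fun x => (1 - cos x) / x ^ 2)); [lra| |].
  - intros x Hx.
    replace ((1 - cos x) / x ^ 2) with (sinc x - (sin x * x - (1 - cos x)) / x ^ 2).
    2:{ rewrite sinc_neq0 by lra. field; lra. }
    apply (is_derive_minus Si cosc); [apply is_derive_Si|].
    unfold cosc. auto_derive; [lra|]. field; lra.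
  - intros x Hx. apply Rdiv_le_0_compat; [generalize (COS_bound x); lra|apply pow_lt; lra]. }
apply Rabs_def2 in H. unfold h, cosc in *. lra.
Qed.

Lemma Si_nonneg (s : R) : 0 < s -> 0 <= Si s.
Proof.
intros Hs. eapply Rle_trans; [|apply Si_lower; trivial].
apply Rdiv_le_0_compat; [generalize (COS_bound s); lra|trivial].
Qed.

(** * The common kernel of both integrands, its primitive, and Abel's bound *)

(** One form for both integrands at [y = 0]: [(al, be)] is [(cos (nu * x), sin (nu * x))] for [u]
    and [(- sin (nu * x), cos (nu * x))] for [v]. Through [sinc] and [cosc] it is continuous at
    [k = nu] as well. *)
Definition kern (al be x k : R) : R :=
  al * ((PI + x) * sinc ((PI + x) * (k - nu)) + (PI - x) * sinc ((PI - x) * (k - nu))) -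
  be * ((PI + x) * cosc ((PI + x) * (k - nu)) - (PI - x) * cosc ((PI - x) * (k - nu))).

Definition kern_prim (al be x k : R) : R :=
  al * (Si ((PI + x) * (k - nu)) + Si ((PI - x) * (k - nu))) -
  be * (Cin ((PI + x) * (k - nu)) - Cin ((PI - x) * (k - nu))).

Lemma continuous_dilation (g : R -> R) (c k : R) :
  (forall t, continuous g t) -> continuous (fun k => c * g (c * (k - nu))) k.
Proof.
intros Hg. apply (continuous_mult (fun _ => c)); [apply continuous_const|].
apply (continuous_comp (fun k => c * (k - nu)) g); [|apply Hg].
apply (ex_derive_continuous (fun k => c * (k - nu))). auto_derive; trivial.
Qed.

Lemma continuous_kern (al be x k : R) : continuous (kern al be x) k.
Proof.
unfold kern.
apply (continuous_minus (fun k => al * ((PI + x) * sinc ((PI + x) * (k - nu)) + (PI - x) * sinc ((PI - x) * (k - nu))))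
  (fun k => be * ((PI + x) * cosc ((PI + x) * (k - nu)) - (PI - x) * cosc ((PI - x) * (k - nu))))).
- apply (continuous_mult (fun _ => al)); [apply continuous_const|].
  apply (continuous_plus (fun k => (PI + x) * sinc ((PI + x) * (k - nu))));
    apply continuous_dilation, continuous_sinc.
- apply (continuous_mult (fun _ => be)); [apply continuous_const|].
  apply (continuous_minus (fun k => (PI + x) * cosc ((PI + x) * (k - nu))));
    apply continuous_dilation, continuous_cosc.
Qed.

Lemma is_derive_dilation (g dg : R -> R) (c k : R) :
  (forall t, is_derive g t (dg t)) ->
  is_derive (fun k => g (c * (k - nu))) k (c * dg (c * (k - nu))).
Proof.
intros Hg. apply (is_derive_comp g (fun k => c * (k - nu))); [apply Hg|].
auto_derive; [trivial|ring].
Qed.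

Lemma is_derive_kern_prim (al be x k : R) :
  is_derive (kern_prim al be x) k (kern al be x k).
Proof.
unfold kern_prim, kern.
apply (is_derive_minus (fun k => al * (Si ((PI + x) * (k - nu)) + Si ((PI - x) * (k - nu))))
  (fun k => be * (Cin ((PI + x) * (k - nu)) - Cin ((PI - x) * (k - nu))))).
- apply (is_derive_scal (fun k => Si ((PI + x) * (k - nu)) + Si ((PI - x) * (k - nu)))).
  apply (is_derive_plus (fun k => Si ((PI + x) * (k - nu))));
    apply is_derive_dilation, is_derive_Si.
- apply (is_derive_scal (fun k => Cin ((PI + x) * (k - nu)) - Cin ((PI - x) * (k - nu)))).
  apply (is_derive_minus (fun k => Cin ((PI + x) * (k - nu))));
    apply is_derive_dilation, is_derive_Cin.
Qed.

(** Each of the four increments is at most [2 / (a * (s - nu))] up to logarithms. Both [Cin] terms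
    carry the same [ln (t - nu) - ln (s - nu)], which cancels in their difference [Q]. *)
Lemma kern_prim_increment (al be x s t : R) :
  -1 <= al <= 1 -> -1 <= be <= 1 -> 0 <= x < PI -> nu < s -> s <= t ->
  Rabs (kern_prim al be x t - kern_prim al be x s) <= 8 / (PI - x) / (s - nu).
Proof.
intros Hal Hbe Hx Hs Hst. unfold kern_prim.
set (a := PI - x). set (b := PI + x).
assert (Ha : 0 < a) by (unfold a; lra).
assert (Hab : a <= b) by (unfold a, b; lra).
assert (Hpos : forall c, 0 < c -> 0 < c * (s - nu) <= c * (t - nu)).
{ intros c Hc. split; [apply Rmult_lt_0_compat; lra|apply Rmult_le_compat_l; lra]. }
generalize (Si_increment _ _ (Hpos a Ha)) (Si_increment _ _ (Hpos b ltac:(lra)))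
  (Cin_ln_increment _ _ (Hpos a Ha)) (Cin_ln_increment _ _ (Hpos b ltac:(lra))).
rewrite !ln_mult by lra.
assert (H8 : 8 / a / (s - nu) = 4 * (2 / (a * (s - nu)))) by (field; lra).
assert (Hba : 2 / (b * (s - nu)) <= 2 / (a * (s - nu))).
{ apply Rmult_le_compat_l; [lra|]. apply Rinv_le_contravar; [apply (Hpos a Ha)|].
  apply Rmult_le_compat_r; lra. }
rewrite H8. generalize dependent (2 / (a * (s - nu))). intros D _ Hba H1 H2 H3 H4.
apply Rabs_le_between in H1, H2, H3, H4.
set (P := Si (b * (t - nu)) + Si (a * (t - nu)) - (Si (b * (s - nu)) + Si (a * (s - nu)))).
set (Q := Cin (b * (t - nu)) - Cin (a * (t - nu)) - (Cin (b * (s - nu)) - Cin (a * (s - nu)))).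
replace (_ - _) with (al * P - be * Q) by (unfold P, Q; ring).
assert (HP : Rabs P <= 2 * D) by (unfold P; apply Rabs_le; lra).
assert (HQ : Rabs Q <= 2 * D) by (unfold Q; apply Rabs_le; lra).
assert (Hal' : Rabs al <= 1) by (apply Rabs_le; lra).
assert (Hbe' : Rabs be <= 1) by (apply Rabs_le; lra).
unfold Rminus. eapply Rle_trans; [apply Rabs_triang|].
rewrite Rabs_Ropp, !Rabs_mult.
generalize (Rabs_pos P) (Rabs_pos Q). nra.
Qed.

(* Abel's test; integration by parts is hidden in the derivative of
   [RInt (a * exp) - (A - A s) * exp]. *)
Lemma abel_bound (A a : R -> R) (D s t y : R) :
  (forall k, is_derive A k (a k)) -> (forall k, continuous a k) ->
  0 <= s -> s <= t -> y <= 0 ->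
  (forall k, s <= k -> Rabs (A k - A s) <= D) ->
  Rabs (RInt (fun k => a k * exp (k * y)) 0 t - RInt (fun k => a k * exp (k * y)) 0 s) <= D.
Proof.
intros HA Ha Hs Hst Hy HD.
set (Z := fun t => RInt (fun k => a k * exp (k * y)) 0 t).
assert (HZ : forall k, is_derive Z k (a k * exp (k * y))).
{ intros k. apply (is_derive_primitive (fun k => a k * exp (k * y))).
  intros z. apply (continuous_mult a); [apply Ha|].
  apply (ex_derive_continuous (fun k => exp (k * y))). auto_derive; trivial. }
assert (H : Rabs ((Z t - (A t - A s) * exp (t * y)) - (Z s - (A s - A s) * exp (s * y)))
  <= - D * exp (t * y) - - D * exp (s * y)).
{ apply (increment_bound (fun k => Z k - (A k - A s) * exp (k * y))
    (fun k => - ((A k - A s) * (y * exp (k * y))))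
    (fun k => - D * exp (k * y)) (fun k => D * (- y * exp (k * y)))); trivial.
  - intros k Hk.
    replace (- ((A k - A s) * (y * exp (k * y))))
      with (a k * exp (k * y) - (a k * exp (k * y) + (A k - A s) * (y * exp (k * y)))) by ring.
    apply (is_derive_minus Z (fun k => (A k - A s) * exp (k * y))); [apply HZ|].
    apply (is_derive_mult (fun k => A k - A s) (fun k => exp (k * y)) k (a k) (y * exp (k * y))).
    + replace (a k) with (a k - 0) by ring.
      apply (is_derive_minus A (fun _ => A s)); [apply HA|apply (@is_derive_const R_AbsRing)].
    + auto_derive; [trivial|ring].
    + intros; apply Rmult_comm.
  - intros k Hk. auto_derive; [trivial|ring].
  - intros k Hk. rewrite Rabs_Ropp, Rabs_mult.
    assert (0 < exp (k * y)) by apply exp_pos.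
    rewrite (Rabs_left1 (y * exp (k * y))) by nra.
    replace (- (y * exp (k * y))) with (- y * exp (k * y)) by ring.
    apply Rmult_le_compat_r; [nra|]. apply HD; lra. }
(* Restoring the boundary term costs at most [D * exp (t * y)], for a total of at most
   [D * exp (s * y) <= D]. *)
generalize (HD t Hst). intros Ht.
assert (HD0 : 0 <= D) by (eapply Rle_trans; [apply Rabs_pos|apply Ht]).
assert (E1 : 0 < exp (t * y)) by apply exp_pos.
assert (E2 : exp (s * y) <= 1).
{ rewrite <- exp_0. destruct (Req_dec (s * y) 0) as [->|]; [lra|].
  left; apply exp_increasing; nra. }
apply Rabs_le_between in H. apply Rabs_le_between in Ht. apply Rabs_le.
fold (Z t) (Z s). split; nra.
Qed.

(** * Convergence of the improper integrals *)

Definition kern_exp (al be x y k : R) : R := kern al be x k * exp (k * y).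

Lemma continuous_kern_exp (al be x y k : R) : continuous (kern_exp al be x y) k.
Proof.
apply (continuous_mult (kern al be x)); [apply continuous_kern|].
apply (ex_derive_continuous (fun k => exp (k * y))). auto_derive; trivial.
Qed.

(** Abel's bound transfers the decay of the increments of [kern_prim] to the weighted integrals. The
    rate is free of [y], which later gives continuity up to the axis. *)
Lemma kern_exp_lim (al be x y : R) :
  -1 <= al <= 1 -> -1 <= be <= 1 -> 0 <= x < PI -> y <= 0 ->
  exists l, filterlim (fun N => RInt (kern_exp al be x y) 0 N)
      (Rbar_locally p_infty) (locally l) /\
    forall N, nu < N -> Rabs (RInt (kern_exp al be x y) 0 N - l) <= 8 / (PI - x) / (N - nu).
Proof.
intros Hal Hbe Hx Hy.
apply (lim_of_increment_bound (fun N => RInt (kern_exp al be x y) 0 N)).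
- apply Rdiv_le_0_compat; lra.
- intros s t Hs Hst. apply (abel_bound (kern_prim al be x) (kern al be x)); trivial.
  + apply is_derive_kern_prim.
  + apply continuous_kern.
  + unfold nu in Hs; lra.
  + intros k Hk. apply kern_prim_increment; trivial.
Qed.

Lemma is_RInt_except_nu (f g : R -> R) (N : R) :
  (forall k, continuous g k) -> (forall k, k <> nu -> f k = g k) -> nu < N ->
  is_RInt f 0 N (RInt g 0 N).
Proof.
intros Hg Hfg HN.
assert (Hnu : 0 < nu) by (unfold nu; lra).
assert (Hex : forall a b, ex_RInt g a b).
{ intros a b. apply (@ex_RInt_continuous R_CompleteNormedModule); auto. }
(* Splitting at [nu] makes the exceptional point an endpoint, and [is_RInt_ext] asks for agreement
   only on open intervals. *)
rewrite <- (RInt_Chasles g 0 nu N) by auto.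
apply (is_RInt_Chasles f 0 nu N); apply (is_RInt_ext g).
- rewrite Rmin_left, Rmax_right by lra. intros k Hk. symmetry; apply Hfg; lra.
- apply (@RInt_correct R_CompleteNormedModule); auto.
- rewrite Rmin_left, Rmax_right by lra. intros k Hk. symmetry; apply Hfg; lra.
- apply (@RInt_correct R_CompleteNormedModule); auto.
Qed.

Lemma RInt_gen_except_nu (f g : R -> R) (l : R) :
  (forall k, continuous g k) -> (forall k, k <> nu -> f k = g k) ->
  filterlim (fun N => RInt g 0 N) (Rbar_locally p_infty) (locally l) ->
  RInt_gen f (at_point 0) (Rbar_locally p_infty) = l.
Proof.
intros Hg Hfg Hl.
apply (@is_RInt_gen_unique R_CompleteNormedModule (at_point 0) (Rbar_locally p_infty) _ _ f l).
intros P HP. destruct (Hl P HP) as [M HM].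
apply (Filter_prod (at_point 0) (Rbar_locally p_infty) _ (fun a => a = 0) (fun b => Rmax M nu < b)).
- reflexivity.
- exists (Rmax M nu); auto.
- intros a b -> Hb. exists (RInt g 0 b); simpl. split.
  + apply is_RInt_except_nu; trivial. generalize (Rmax_r M nu); lra.
  + apply HM. generalize (Rmax_l M nu); lra.
Qed.

(** The triangle inequality bounds increments by [2 * C / (s - T)], so a limit [m] exists with that
    rate. Then [|m - l| <= 3 * C / (s - T)] for every [s > T] forces [m = l]. *)
Lemma lim_of_bound (F : R -> R) (C T l : R) :
  (forall s, T < s -> Rabs (F s - l) <= C / (s - T)) ->
  filterlim F (Rbar_locally p_infty) (locally l).
Proof.
intros H.
assert (HC : 0 <= C).
{ generalize (Rle_trans _ _ _ (Rabs_pos _) (H (T + 1) ltac:(lra))).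
  replace (T + 1 - T) with 1 by ring. unfold Rdiv; rewrite Rinv_1; lra. }
destruct (lim_of_increment_bound F (2 * C) T) as [m [Hm Hb]]; [lra| |].
{ intros s t Hs Hst. generalize (H s Hs) (H t ltac:(lra)). intros H1 H2.
  assert (C / (t - T) <= C / (s - T)).
  { apply Rmult_le_compat_l; trivial. apply Rinv_le_contravar; lra. }
  replace (2 * C / (s - T)) with (C / (s - T) + C / (s - T)) by (field; lra).
  replace (F t - F s) with ((F t - l) - (F s - l)) by ring.
  unfold Rminus at 1. eapply Rle_trans; [apply Rabs_triang|]. rewrite Rabs_Ropp. lra. }
replace l with m; trivial.
apply cond_eq. intros e He.
set (s := T + 3 * C / e + 1).
assert (Hce : 0 <= 3 * C / e) by (apply Rdiv_le_0_compat; lra).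
assert (Hs : T < s) by (unfold s; lra).
generalize (H s Hs) (Hb s Hs). intros H1 H2.
replace (m - l) with ((F s - l) - (F s - m)) by ring.
unfold Rminus at 1. eapply Rle_lt_trans; [apply Rabs_triang|]. rewrite Rabs_Ropp.
assert (H3 : C / (s - T) + 2 * C / (s - T) < e).
{ replace (C / (s - T) + 2 * C / (s - T)) with (3 * C / (s - T)) by (field; lra).
  apply Rmult_lt_reg_r with (s - T); [lra|].
  unfold Rdiv; rewrite Rmult_assoc, Rinv_l, Rmult_1_r by lra.
  replace (s - T) with (3 * C / e + 1) by (unfold s; ring).
  replace (e * (3 * C / e + 1)) with (3 * C + e) by (field; lra). lra. }
lra.
Qed.

(** * The integrals on the x-axis in closed form *)

Lemma Si_lim : exists D, 0 <= D /\ forall s, 0 < s -> Rabs (Si s - D) <= 2 / s.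
Proof.
destruct (lim_of_increment_bound Si 2 0) as [D [_ HD]]; [lra| |].
{ intros s t Hs Hst. rewrite Rminus_0_r. apply Si_increment; lra. }
exists D; split.
- apply Rle_plus_epsilon. intros e He.
  (* At [s = 2 / e] the rate equals [e], while [Si s >= 0]; hence [D >= - e]. *)
  assert (Hp : 0 < 2 / e) by (apply Rdiv_lt_0_compat; lra).
  generalize (HD (2 / e) Hp) (Si_nonneg (2 / e) Hp). rewrite Rminus_0_r.
  replace (2 / (2 / e)) with e by (field; lra).
  intros H1 H2. apply Rabs_le_between in H1. lra.
- intros s Hs. generalize (HD s Hs). rewrite Rminus_0_r; trivial.
Qed.

(** Since [sinc] is even, [Si t + Si (- t)] has derivative 0; the increment bound applies with the
    zero function as [g]. *)
Lemma Si_opp (s : R) : 0 <= s -> Si (- s) = - Si s.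
Proof.
intros Hs.
assert (H : Rabs ((Si s + Si (- s)) - (Si 0 + Si (- 0))) <= 0 - 0).
{ apply (increment_bound (fun t => Si t + Si (- t)) (fun t => sinc t + - sinc (- t))
    (fun _ => 0) (fun _ => 0)); trivial.
  - intros t _. apply (is_derive_plus Si (fun t => Si (- t))); [apply is_derive_Si|].
    replace (- sinc (- t)) with ((-1) * sinc (- t)) by ring.
    apply (is_derive_comp Si Ropp); [apply is_derive_Si|].
    auto_derive; [trivial|ring].
  - intros t _. apply (@is_derive_const R_AbsRing).
  - intros t _. replace (sinc (- t)) with (sinc t).
    + rewrite Rplus_opp_r, Rabs_R0; lra.
    + destruct (Req_dec t 0) as [->|Ht]; [f_equal; ring|].
      rewrite !sinc_neq0 by lra. rewrite sin_neg. field; trivial. }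
assert (S0 : Si 0 = 0) by apply (@RInt_point R_CompleteNormedModule).
rewrite Ropp_0, S0 in H. generalize (Rabs_pos (Si s + Si (- s) - (0 + 0))).
intros. destruct (Req_dec (Si s + Si (- s) - (0 + 0)) 0) as [|Hn]; [lra|].
apply Rabs_pos_lt in Hn. lra.
Qed.

(* [D] stands for the limit of [Si] at infinity. *)
Definition trace_cos (D x : R) : R :=
  2 * D - Si ((PI + x) * (0 - nu)) - Si ((PI - x) * (0 - nu)).

(** With [a = PI - x] and [b = PI + x], this is the integral of [(cos (a * (k - nu)) - cos (b * (k -
    nu))) / (k - nu)] over [k > 0]. The logarithms are the limit of [Cin (b * s) - Cin (a * s)]. *)
Definition trace_sin (x : R) : R :=
  ln (PI + x) - ln (PI - x) - Cin ((PI + x) * (0 - nu)) + Cin ((PI - x) * (0 - nu)).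

(** At [y = 0] the truncated integral is exactly an increment of [kern_prim], whose upper end
    converges at a known rate. *)
Lemma kern_trace_lim (D al be x : R) :
  (forall s, 0 < s -> Rabs (Si s - D) <= 2 / s) ->
  -1 <= al <= 1 -> -1 <= be <= 1 -> 0 <= x < PI ->
  filterlim (fun N => RInt (kern_exp al be x 0) 0 N) (Rbar_locally p_infty)
    (locally (al * trace_cos D x - be * trace_sin x)).
Proof.
intros HD Hal Hbe Hx.
apply lim_of_bound with (C := 8 / (PI - x)) (T := nu).
intros s Hs.
replace (RInt (kern_exp al be x 0) 0 s) with (kern_prim al be x s - kern_prim al be x 0).
2:{ symmetry. apply (@is_RInt_unique R_CompleteNormedModule).
  apply (@is_RInt_derive R_CompleteNormedModule (kern_prim al be x)).
  - intros k _. unfold kern_exp. rewrite Rmult_0_r, exp_0, Rmult_1_r. apply is_derive_kern_prim.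
  - intros k _. apply continuous_kern_exp. }
unfold kern_prim, trace_cos, trace_sin.
set (a := PI - x). set (b := PI + x).
assert (Ha : 0 < a) by (unfold a; lra).
assert (Hab : a <= b) by (unfold a, b; lra).
assert (Has : 0 < a * (s - nu)) by (apply Rmult_lt_0_compat; lra).
assert (Hbs : a * (s - nu) <= b * (s - nu)) by (apply Rmult_le_compat_r; lra).
(* Here [Cin_ln_increment] compares the arguments [a * (s - nu)] and [b * (s - nu)] at the same [s],
   which produces [ln b - ln a]. *)
generalize (HD _ Has) (HD _ (Rlt_le_trans _ _ _ Has Hbs))
  (Cin_ln_increment _ _ (conj Has Hbs)).
rewrite !ln_mult by lra.
assert (H8 : 8 / a / (s - nu) = 4 * (2 / (a * (s - nu)))) by (field; lra).
assert (Hba : 2 / (b * (s - nu)) <= 2 / (a * (s - nu))).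
{ apply Rmult_le_compat_l; [lra|]. apply Rinv_le_contravar; lra. }
rewrite H8. generalize dependent (2 / (a * (s - nu))). intros E _ Hba H1 H2 H3.
apply Rabs_le_between in H1, H2, H3.
set (P := Si (b * (s - nu)) + Si (a * (s - nu)) - 2 * D).
set (Q := Cin (b * (s - nu)) - Cin (a * (s - nu)) - (ln b - ln a)).
match goal with |- Rabs ?z <= _ => replace z with (al * P - be * Q) by (unfold P, Q; ring) end.
assert (HP : Rabs P <= 2 * E) by (unfold P; apply Rabs_le; lra).
assert (HQ : Rabs Q <= E) by (unfold Q; apply Rabs_le; lra).
assert (Hal' : Rabs al <= 1) by (apply Rabs_le; lra).
assert (Hbe' : Rabs be <= 1) by (apply Rabs_le; lra).
unfold Rminus. eapply Rle_trans; [apply Rabs_triang|].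
rewrite Rabs_Ropp, !Rabs_mult.
generalize (Rabs_pos P) (Rabs_pos Q). nra.
Qed.

(** * Reduction of the integrands of [u] and [v] to the kernel *)

(** The value [nu = 3 / 2] enters here: [PI * nu] is [PI + PI / 2], so sine and cosine trade
    places. *)
Lemma sin_cos_nu_minus (x : R) :
  sin ((PI - x) * nu) = - cos (nu * x) /\ cos ((PI - x) * nu) = - sin (nu * x).
Proof.
replace ((PI - x) * nu) with (PI + (PI / 2 - nu * x)) by (unfold nu; field).
rewrite !sin_plus, !cos_plus, sin_minus, cos_minus, sin_PI, cos_PI, sin_PI2, cos_PI2. split; ring.
Qed.

Lemma sin_cos_nu_plus (x : R) :
  sin ((PI + x) * nu) = - cos (nu * x) /\ cos ((PI + x) * nu) = sin (nu * x).
Proof.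
replace ((PI + x) * nu) with (PI + (PI / 2 + nu * x)) by (unfold nu; field).
rewrite !sin_plus, !cos_plus, ?sin_plus, sin_PI, cos_PI, sin_PI2, cos_PI2. split; ring.
Qed.

Lemma kern_closed_form (al be x k : R) :
  0 <= x < PI -> k <> nu ->
  kern al be x k =
    (al * (sin ((PI + x) * (k - nu)) + sin ((PI - x) * (k - nu))) -
     be * (cos ((PI - x) * (k - nu)) - cos ((PI + x) * (k - nu)))) / (k - nu).
Proof.
intros Hx Hk. unfold kern, cosc.
rewrite !sinc_neq0 by (apply Rmult_integral_contrapositive; lra).
field. lra.
Qed.

Definition u_integrand (x y k : R) : R :=
  (cos (k * (x - PI)) + cos (k * (x + PI))) / (k - nu) * exp (k * y).

Definition v_integrand (x y k : R) : R :=
  (sin (k * (x - PI)) + sin (k * (x + PI))) / (nu - k) * exp (k * y).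

(** Writing [k = (k - nu) + nu] in the phases, the addition formulas split off coefficients that
    depend on [nu * x] only. *)
Lemma u_integrand_kern (x y k : R) :
  0 <= x < PI -> k <> nu ->
  u_integrand x y k = kern_exp (cos (nu * x)) (sin (nu * x)) x y k.
Proof.
intros Hx Hk. unfold u_integrand, kern_exp. rewrite kern_closed_form by trivial. f_equal. f_equal.
replace (k * (x - PI)) with (- ((PI - x) * (k - nu) + (PI - x) * nu)) by ring.
replace (k * (x + PI)) with ((PI + x) * (k - nu) + (PI + x) * nu) by ring.
rewrite cos_neg, !cos_plus.
rewrite (proj1 (sin_cos_nu_minus x)), (proj2 (sin_cos_nu_minus x)),
  (proj1 (sin_cos_nu_plus x)), (proj2 (sin_cos_nu_plus x)). ring.
Qed.

Lemma v_integrand_kern (x y k : R) :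
  0 <= x < PI -> k <> nu ->
  v_integrand x y k = kern_exp (- sin (nu * x)) (cos (nu * x)) x y k.
Proof.
intros Hx Hk. unfold v_integrand, kern_exp. rewrite kern_closed_form by trivial. f_equal.
replace (k * (x - PI)) with (- ((PI - x) * (k - nu) + (PI - x) * nu)) by ring.
replace (k * (x + PI)) with ((PI + x) * (k - nu) + (PI + x) * nu) by ring.
rewrite sin_neg, !sin_plus.
rewrite (proj1 (sin_cos_nu_minus x)), (proj2 (sin_cos_nu_minus x)),
  (proj1 (sin_cos_nu_plus x)), (proj2 (sin_cos_nu_plus x)). field. lra.
Qed.

Definition u_trace (D x : R) : R :=
  cos (nu * x) * trace_cos D x - sin (nu * x) * trace_sin x.

Definition v_trace (D x : R) : R :=
  - sin (nu * x) * trace_cos D x - cos (nu * x) * trace_sin x.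

Lemma u_trace_eq (D x : R) :
  (forall s, 0 < s -> Rabs (Si s - D) <= 2 / s) -> 0 <= x < PI -> u x 0 = u_trace D x.
Proof.
intros HD Hx.
apply (RInt_gen_except_nu _ (kern_exp (cos (nu * x)) (sin (nu * x)) x 0)).
- apply continuous_kern_exp.
- intros k Hk. apply u_integrand_kern; trivial.
- apply kern_trace_lim; trivial; [apply COS_bound|apply SIN_bound].
Qed.

Lemma opp_SIN_bound (t : R) : -1 <= - sin t <= 1.
Proof. generalize (SIN_bound t); lra. Qed.

Lemma v_trace_eq (D x : R) :
  (forall s, 0 < s -> Rabs (Si s - D) <= 2 / s) -> 0 <= x < PI -> v x 0 = v_trace D x.
Proof.
intros HD Hx.
apply (RInt_gen_except_nu _ (kern_exp (- sin (nu * x)) (cos (nu * x)) x 0)).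
- apply continuous_kern_exp.
- intros k Hk. apply v_integrand_kern; trivial.
- apply kern_trace_lim; trivial; [apply opp_SIN_bound|apply COS_bound].
Qed.

(** The tail bound is uniform in [y <= 0]. The truncated integral is kept in terms of [v_integrand],
    whose product form makes integrands at different points easy to compare. *)
Lemma v_truncation (x y N : R) :
  0 <= x < PI -> y <= 0 -> nu < N ->
  exists I, is_RInt (v_integrand x y) 0 N I /\ Rabs (I - v x y) <= 8 / (PI - x) / (N - nu).
Proof.
intros Hx Hy HN.
destruct (kern_exp_lim (- sin (nu * x)) (cos (nu * x)) x y) as [l [Hl Hb]]; trivial;
  [apply opp_SIN_bound|apply COS_bound|].
exists (RInt (kern_exp (- sin (nu * x)) (cos (nu * x)) x y) 0 N). split.
- apply is_RInt_except_nu; trivial; [apply continuous_kern_exp|].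
  intros k Hk; apply v_integrand_kern; trivial.
- replace (v x y) with l; [apply Hb; trivial|].
  symmetry. apply (RInt_gen_except_nu _ (kern_exp (- sin (nu * x)) (cos (nu * x)) x y)); trivial.
  + apply continuous_kern_exp.
  + intros k Hk; apply v_integrand_kern; trivial.
Qed.

(** * Continuity of [v] up to the axis and its zero at the end of the nodal line *)

Lemma sin_lipschitz (s t : R) : Rabs (sin s - sin t) <= Rabs (s - t).
Proof.
assert (H : forall s t, s <= t -> Rabs (sin t - sin s) <= t - s).
{ intros s' t' Hst.
  apply (increment_bound sin cos (fun t => t) (fun _ => 1)); trivial.
  - intros; apply is_derive_sin.
  - intros; apply (@is_derive_id R_AbsRing).
  - intros x _; apply Rabs_le, COS_bound. }
destruct (Rle_dec s t) as [Hst|Hst].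
- rewrite Rabs_minus_sym, (Rabs_minus_sym s), (Rabs_pos_eq (t - s)) by lra. auto.
- rewrite (Rabs_pos_eq (s - t)) by lra. apply H; lra.
Qed.

(** The two sines add up to [2 * sin (k * x) * cos (k * PI)]. As
    [cos (k * PI) = sin (PI * (k - nu))], the bound [|sin z| <= |z|] controls the quotient near
    [k = nu]. *)
Lemma v_integrand_factor (k : R) :
  exists c, Rabs c <= 2 * PI /\ forall x y, v_integrand x y k = c * (sin (k * x) * exp (k * y)).
Proof.
assert (HPI := PI_RGT_0).
exists (2 * cos (k * PI) / (nu - k)). split.
- replace (cos (k * PI)) with (sin (PI * (k - nu))).
  2:{ replace (PI * (k - nu)) with (k * PI - (PI / 2 + PI)) by (unfold nu; field).
    rewrite sin_minus, sin_plus, cos_plus, sin_PI, cos_PI, sin_PI2, cos_PI2. ring. }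
  destruct (Req_dec k nu) as [->|Hk].
  (* At [k = nu] the numerator vanishes, so total division gives the factor 0. *)
  + rewrite Rminus_diag, Rmult_0_r, sin_0. unfold Rdiv.
    rewrite Rmult_0_r, Rmult_0_l, Rabs_R0. lra.
  + assert (Hp : 0 < Rabs (nu - k)) by (apply Rabs_pos_lt; lra).
    rewrite Rabs_div, Rabs_mult, (Rabs_pos_eq 2) by lra.
    apply Rmult_le_reg_r with (Rabs (nu - k)); trivial.
    unfold Rdiv; rewrite Rmult_assoc, Rinv_l, Rmult_1_r by lra.
    generalize (abs_sin_le (PI * (k - nu))).
    rewrite Rabs_mult, (Rabs_pos_eq PI), (Rabs_minus_sym k) by lra. nra.
- intros x' y'. unfold v_integrand.
  replace (k * (x' - PI)) with (k * x' - k * PI) by ring.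
  replace (k * (x' + PI)) with (k * x' + k * PI) by ring.
  rewrite sin_minus, sin_plus. unfold Rdiv; ring.
Qed.

(** After factoring, the exponential varies by [1 - exp (k * y) <= - (k * y)] and the sine by at
    most [k * |x - x0|]. *)
Lemma v_integrand_increment (x x0 y k : R) :
  0 <= k -> y <= 0 ->
  Rabs (v_integrand x y k - v_integrand x0 0 k) <= 2 * PI * (k * (Rabs (x - x0) - y)).
Proof.
intros Hk Hy. destruct (v_integrand_factor k) as [c [Hc E]].
rewrite !E, <- Rmult_minus_distr_l, Rabs_mult.
apply Rmult_le_compat; try apply Rabs_pos; trivial.
rewrite Rmult_0_r, exp_0, Rmult_1_r.
replace (sin (k * x) * exp (k * y) - sin (k * x0))
  with (sin (k * x) * (exp (k * y) - 1) + (sin (k * x) - sin (k * x0))) by ring.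
eapply Rle_trans; [apply Rabs_triang|].
generalize (sin_lipschitz (k * x) (k * x0)).
rewrite <- Rmult_minus_distr_l, Rabs_mult, (Rabs_pos_eq k) by trivial.
assert (Rabs (sin (k * x)) <= 1) by apply Rabs_le, SIN_bound.
assert (exp (k * y) <= 1).
{ rewrite <- exp_0. destruct (Req_dec (k * y) 0) as [->|]; [lra|].
  left; apply exp_increasing; nra. }
generalize (exp_ineq1_le (k * y)). intros.
rewrite Rabs_mult, (Rabs_left1 (exp (k * y) - 1)) by lra.
generalize (Rabs_pos (sin (k * x))). nra.
Qed.

(** Both integrals are cut at [N]: two tail errors, plus the integrand bound with [k <= N] over an
    interval of length [N]. *)
Lemma v_increment (x x0 y N : R) :
  0 <= x < PI -> 0 <= x0 < PI -> y <= 0 -> nu < N ->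
  Rabs (v x y - v x0 0) <=
    8 / (PI - x) / (N - nu) + 8 / (PI - x0) / (N - nu) +
    N * (2 * PI * (N * (Rabs (x - x0) - y))).
Proof.
intros Hx Hx0 Hy HN.
assert (HN0 : 0 < N) by (unfold nu in HN; lra).
destruct (v_truncation x y N) as [I [HI HIb]]; trivial.
destruct (v_truncation x0 0 N) as [J [HJ HJb]]; trivial; [lra|].
assert (H : Rabs (I - J) <= (N - 0) * (2 * PI * (N * (Rabs (x - x0) - y)))).
{ apply (norm_RInt_le_const (fun k => minus (v_integrand x y k) (v_integrand x0 0 k)) 0 N
    (minus I J)); [lra| |apply (is_RInt_minus _ _ _ _ _ _ HI HJ)].
  intros k Hk. eapply Rle_trans; [apply v_integrand_increment; lra|].
  generalize PI_RGT_0 (Rabs_pos (x - x0)); intros.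
  apply Rmult_le_compat_l; [lra|]. apply Rmult_le_compat_r; lra. }
rewrite Rminus_0_r in H.
replace (v x y - v x0 0) with (- (I - v x y) + ((J - v x0 0) + (I - J))) by ring.
eapply Rle_trans; [apply Rabs_triang|]. rewrite Rabs_Ropp.
generalize (Rabs_triang (J - v x0 0) (I - J)). lra.
Qed.

Lemma v_boundary_value (gam : R -> R * R) (x0 : R) : nodal_line gam x0 -> v x0 0 = 0.
Proof.
intros Hg. destruct (nodal_end_range _ _ Hg) as [Hx0 Hx1].
apply cond_eq. intros e He. rewrite Rminus_0_r.
set (a := PI - x0).
assert (Ha : 0 < a) by (unfold a; lra).
(* This [N] makes the tail at [x0] equal to [e / 6], and the tail at [x] at most [e / 3] once
   [PI - x >= a / 2]. *)
set (N := nu + 48 / (a * e)).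
assert (Hae : 0 < a * e) by (apply Rmult_lt_0_compat; trivial).
assert (HN : nu < N) by (unfold N; generalize (Rdiv_lt_0_compat 48 (a * e) ltac:(lra) Hae); lra).
assert (HN0 : 0 < N) by (unfold nu in HN; lra).
set (M := N * (2 * PI * N)).
assert (HM : 0 < M) by (apply Rmult_lt_0_compat; [trivial|apply Rmult_lt_0_compat; lra]).
(* The three terms ensure [0 <= x], [PI - x >= a / 2], and a contribution of at most
   [M * (2 * d) <= e / 4] from the truncated integrals. *)
set (d := Rmin (Rmin x0 (a / 2)) (e / (8 * M))).
assert (Hd : 0 < d).
{ unfold d; repeat apply Rmin_glb_lt; try lra. apply Rdiv_lt_0_compat; lra. }
assert (D1 : d <= x0) by (unfold d; eapply Rle_trans; [apply Rmin_l|apply Rmin_l]).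
assert (D2 : d <= a / 2) by (unfold d; eapply Rle_trans; [apply Rmin_l|apply Rmin_r]).
assert (D3 : d <= e / (8 * M)) by apply Rmin_r.
destruct (proj1 (@filterlim_locally _ (prod_UniformSpace R_UniformSpace R_UniformSpace)
  (at_left 1) _ gam (x0, 0)) (nodal_right_end _ _ Hg) (mkposreal d Hd)) as [r Hr].
set (t := 1 - Rmin (r / 2) 1).
assert (Hr1 : 0 < Rmin (r / 2) 1) by (apply Rmin_glb_lt; generalize (cond_pos r); lra).
assert (Hr2 := Rmin_l (r / 2) 1). assert (Hr3 := Rmin_r (r / 2) 1).
assert (Ht : -1 < t < 1) by (unfold t; lra).
destruct (Hr t) as [Bx By].
{ change (Rabs (t - 1) < r). unfold t. rewrite Rabs_left1; generalize (cond_pos r); lra. }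
{ lra. }
assert (Harc : arc gam (gam t)) by (exists t; auto).
destruct (gam t) as [x y].
change (Rabs (x - x0) < d) in Bx. change (Rabs (y - 0) < d) in By.
assert (Hy : y < 0) by apply (nodal_lower _ _ Hg _ Harc).
assert (Hv : v x y = 0) by (apply (nodal_zeros _ _ Hg x y Hy); auto).
rewrite Rminus_0_r, Rabs_left in By by trivial.
assert (Bx' := Rabs_def2 _ _ Bx).
assert (H : Rabs (v x y - v x0 0) <= 8 / (PI - x) / (N - nu) + 8 / (PI - x0) / (N - nu) +
    N * (2 * PI * (N * (Rabs (x - x0) - y)))).
{ apply v_increment; unfold a in *; lra. }
rewrite Hv, Rminus_0_l, Rabs_Ropp in H.
eapply Rle_lt_trans; [apply H|].
assert (E0 : N - nu = 48 / (a * e)) by (unfold N; ring).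
assert (E2 : 8 / (PI - x0) / (N - nu) = e / 6).
{ fold a. rewrite E0. field. lra. }
assert (E1 : 8 / (PI - x) / (N - nu) <= e / 3).
{ apply Rle_trans with (8 / (a / 2) / (N - nu)); [|rewrite E0; right; field; lra].
  unfold Rdiv at 1 3. apply Rmult_le_compat_r; [left; apply Rinv_0_lt_compat; lra|].
  apply Rmult_le_compat_l; [lra|]. apply Rinv_le_contravar; unfold a in *; lra. }
assert (E3 : N * (2 * PI * (N * (Rabs (x - x0) - y))) <= e / 4).
{ replace (N * (2 * PI * (N * (Rabs (x - x0) - y)))) with (M * (Rabs (x - x0) - y)) by (unfold M; ring).
  replace (e / 4) with (M * (2 * (e / (8 * M)))) by (field; lra).
  apply Rmult_le_compat_l; lra. }
lra.
Qed.

(** * Differential equations for the traces *)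

(** The chain rule gives [sin (b * nu) / b - sin (a * nu) / a] with [a = PI - x], [b = PI + x], and
    both sines equal [- cos (nu * x)]. Allowing negative [x] makes the derivative at 0 two-sided. *)
Lemma is_derive_trace_cos (D x : R) : -PI < x < PI ->
  is_derive (trace_cos D) x (cos (nu * x) * (/ (PI - x) - / (PI + x))).
Proof.
intros Hx.
replace (cos (nu * x) * (/ (PI - x) - / (PI + x)))
  with (0 - (- nu) * sinc ((PI + x) * (0 - nu)) - nu * sinc ((PI - x) * (0 - nu))).
- apply (is_derive_minus (fun x => 2 * D - Si ((PI + x) * (0 - nu))) (fun x => Si ((PI - x) * (0 - nu)))).
  + apply (is_derive_minus (fun _ => 2 * D) (fun x => Si ((PI + x) * (0 - nu)))).
    * apply (@is_derive_const R_AbsRing).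
    * apply (is_derive_comp Si (fun x => (PI + x) * (0 - nu))); [apply is_derive_Si|].
      auto_derive; [trivial|ring].
  + apply (is_derive_comp Si (fun x => (PI - x) * (0 - nu))); [apply is_derive_Si|].
    auto_derive; [trivial|ring].
- assert (Hnu : nu <> 0) by (unfold nu; lra).
  rewrite !sinc_neq0 by (apply Rmult_integral_contrapositive; lra).
  replace ((PI + x) * (0 - nu)) with (- ((PI + x) * nu)) by ring.
  replace ((PI - x) * (0 - nu)) with (- ((PI - x) * nu)) by ring.
  rewrite !sin_neg, (proj1 (sin_cos_nu_minus x)), (proj1 (sin_cos_nu_plus x)).
  field. repeat split; lra.
Qed.

(** The reciprocals from the logarithms cancel the constant parts of the two [cosc] terms, leaving
    only multiples of [sin (nu * x)]. *)
Lemma is_derive_trace_sin (x : R) : -PI < x < PI ->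
  is_derive trace_sin x (- sin (nu * x) * (/ (PI - x) - / (PI + x))).
Proof.
intros Hx.
replace (- sin (nu * x) * (/ (PI - x) - / (PI + x)))
  with ((/ (PI + x) + / (PI - x)) - (- nu) * cosc ((PI + x) * (0 - nu)) +
    nu * cosc ((PI - x) * (0 - nu))).
- apply (is_derive_plus (fun x => ln (PI + x) - ln (PI - x) - Cin ((PI + x) * (0 - nu)))
    (fun x => Cin ((PI - x) * (0 - nu)))).
  + apply (is_derive_minus (fun x => ln (PI + x) - ln (PI - x)) (fun x => Cin ((PI + x) * (0 - nu)))).
    * auto_derive; [repeat split; lra|]. field; lra.
    * apply (is_derive_comp Cin (fun x => (PI + x) * (0 - nu))); [apply is_derive_Cin|].
      auto_derive; [trivial|ring].
  + apply (is_derive_comp Cin (fun x => (PI - x) * (0 - nu))); [apply is_derive_Cin|].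
    auto_derive; [trivial|ring].
- assert (Hnu : nu <> 0) by (unfold nu; lra). unfold cosc.
  replace ((PI + x) * (0 - nu)) with (- ((PI + x) * nu)) by ring.
  replace ((PI - x) * (0 - nu)) with (- ((PI - x) * nu)) by ring.
  rewrite !cos_neg, (proj2 (sin_cos_nu_minus x)), (proj2 (sin_cos_nu_plus x)).
  field. repeat split; lra.
Qed.

(** The terms in [r] cancel. This is the Cauchy-Riemann equation [v_x = - u_y] combined with
    [u_y = nu * u] on the axis. *)
Lemma is_derive_v_trace (D x : R) : -PI < x < PI ->
  is_derive (v_trace D) x (- nu * u_trace D x).
Proof.
intros Hx. set (r := / (PI - x) - / (PI + x)).
replace (- nu * u_trace D x) with
  ((- nu * cos (nu * x) * trace_cos D x + - sin (nu * x) * (cos (nu * x) * r)) -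
   (- nu * sin (nu * x) * trace_sin x + cos (nu * x) * (- sin (nu * x) * r)))
  by (unfold u_trace; ring).
apply (is_derive_minus (fun x => - sin (nu * x) * trace_cos D x) (fun x => cos (nu * x) * trace_sin x)).
- apply (is_derive_mult (fun x => - sin (nu * x)) (trace_cos D)).
  + auto_derive; [trivial|ring].
  + apply is_derive_trace_cos; trivial.
  + intros; apply Rmult_comm.
- apply (is_derive_mult (fun x => cos (nu * x)) trace_sin).
  + auto_derive; [trivial|ring].
  + apply is_derive_trace_sin; trivial.
  + intros; apply Rmult_comm.
Qed.

(** Here the terms in [r] combine through [sin^2 + cos^2 = 1] to [r] itself. *)
Lemma is_derive_u_trace (D x : R) : -PI < x < PI ->
  is_derive (u_trace D) x (nu * v_trace D x + (/ (PI - x) - / (PI + x))).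
Proof.
intros Hx. set (r := / (PI - x) - / (PI + x)).
replace (nu * v_trace D x + r) with
  ((- nu * sin (nu * x) * trace_cos D x + cos (nu * x) * (cos (nu * x) * r)) -
   (nu * cos (nu * x) * trace_sin x + sin (nu * x) * (- sin (nu * x) * r))).
2:{ generalize (sin2_cos2 (nu * x)). unfold Rsqr, v_trace. intros E.
  replace r with ((sin (nu * x) * sin (nu * x) + cos (nu * x) * cos (nu * x)) * r) at 3
    by (rewrite E; ring). ring. }
apply (is_derive_minus (fun x => cos (nu * x) * trace_cos D x) (fun x => sin (nu * x) * trace_sin x)).
- apply (is_derive_mult (fun x => cos (nu * x)) (trace_cos D)).
  + auto_derive; [trivial|ring].
  + apply is_derive_trace_cos; trivial.
  + intros; apply Rmult_comm.
- apply (is_derive_mult (fun x => sin (nu * x)) trace_sin).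
  + auto_derive; [trivial|ring].
  + apply is_derive_trace_sin; trivial.
  + intros; apply Rmult_comm.
Qed.

(** * Values at the origin and location of the minimum *)

(** The value is [2 * D + 2 * Si (PI * nu)], and [Si (PI * nu) >= / (PI * nu)] because
    [cos (PI * nu) = 0]. *)
Lemma u_trace_0_pos (D : R) : 0 <= D -> 0 < u_trace D 0.
Proof.
intros HD. unfold u_trace, trace_cos.
rewrite Rmult_0_r, cos_0, sin_0, Rplus_0_r, Rminus_0_r.
assert (HP : 0 < PI * nu) by (generalize PI_RGT_0; unfold nu; lra).
replace (PI * (0 - nu)) with (- (PI * nu)) by ring.
rewrite Si_opp by lra.
generalize (Si_lower _ HP) (proj2 (sin_cos_nu_plus 0)).
rewrite Rplus_0_r, Rmult_0_r, sin_0. intros H E. rewrite E in H.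
assert (0 < (1 - 0) / (PI * nu)) by (apply Rdiv_lt_0_compat; lra). lra.
Qed.

Lemma v_trace_0 (D : R) : v_trace D 0 = 0.
Proof.
unfold v_trace, trace_sin. rewrite Rmult_0_r, sin_0, Rplus_0_r, Rminus_0_r. ring.
Qed.

Lemma closure_free_surface (x0 : R) (p : R * R) :
  closure (free_surface x0) p -> 0 <= fst p <= x0 /\ snd p = 0.
Proof.
destruct p as [x y]. intros H. simpl.
assert (W : forall e, 0 < e -> exists q, Rabs (q - x) < e /\ 0 < q < x0 /\ Rabs (0 - y) < e).
{ intros e He.
  destruct (H (ball ((x, y) : R * R) (mkposreal e He))) as [[q1 q2] [[B1 B2] [H1 H2]]].
  - exists (mkposreal e He); auto.
  - simpl in *. subst q2. exists q1. auto. }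
repeat split.
- apply Rnot_lt_le. intros Hx. destruct (W (- x)) as [q [Hq [Hq0 _]]]; [lra|].
  apply Rabs_def2 in Hq. lra.
- apply Rnot_lt_le. intros Hx. destruct (W (x - x0)) as [q [Hq [Hq0 _]]]; [lra|].
  apply Rabs_def2 in Hq. lra.
- apply cond_eq. intros e He. destruct (W e He) as [q [_ [_ Hy]]].
  rewrite Rabs_minus_sym; trivial.
Qed.

Theorem theorem2 (gam : R -> R * R) (x0 : R) (W : R * R -> Prop)
  (hgam : nodal_line gam x0) (hW : fluid_domain gam x0 W) :
  exists xh : R, 0 < xh < x0 /\ interior_high_spot (free_surface x0) u (xh, 0).
Proof.
destruct (nodal_end_range _ _ hgam) as [Hx0 Hx1].
destruct Si_lim as [D [HD0 HD]].
assert (Hv0 : v_trace D x0 = 0).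
{ rewrite <- v_trace_eq by (trivial; lra). apply (v_boundary_value gam), hgam. }
destruct (continuity_ab_min (u_trace D) 0 x0) as [xh [Hmin Hxh]]; [lra| |].
{ intros x Hx. apply continuity_pt_filterlim, (ex_derive_continuous (u_trace D)).
  eexists; apply is_derive_u_trace; lra. }
assert (Hn0 : xh <> 0).
{ intros ->. assert (U0 := u_trace_0_pos D HD0).
  (* Comparison with a line: the difference has derivative [nu * (u_trace D x - u_trace D 0) >= 0]
     when the minimum is at 0. *)
  assert (H : - nu * u_trace D 0 * 0 - v_trace D 0 <= - nu * u_trace D 0 * x0 - v_trace D x0).
  { apply (nondecreasing_of_deriv (fun x => - nu * u_trace D 0 * x - v_trace D x)
      (fun x => - nu * u_trace D 0 - - nu * u_trace D x)); [lra| |].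
    - intros x Hx.
      apply (is_derive_minus (fun x => - nu * u_trace D 0 * x) (v_trace D)).
      + auto_derive; [trivial|ring].
      + apply is_derive_v_trace; lra.
    - intros x Hx. generalize (Hmin x Hx). unfold nu. lra. }
  rewrite v_trace_0, Hv0 in H.
  assert (0 < u_trace D 0 * x0) by (apply Rmult_lt_0_compat; trivial).
  unfold nu in H. lra. }
assert (Hn1 : xh <> x0).
{ intros ->.
  set (r := / (PI - x0) - / (PI + x0)).
  assert (Hr : 0 < r) by (unfold r; apply Rlt_0_minus, Rinv_lt_contravar; [apply Rmult_lt_0_compat|]; lra).
  assert (Hd : is_derive (u_trace D) x0 r).
  { replace r with (nu * v_trace D x0 + r) by (rewrite Hv0; ring).
    apply is_derive_u_trace; lra. }
  apply is_derive_Reals in Hd.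
  (* With the derivative [r] itself as tolerance, difference quotients near [x0] are positive,
     whereas minimality at [x0] makes the one with step [- h] nonpositive. *)
  destruct (Hd r Hr) as [d Hdd].
  set (h := Rmin (d / 2) x0).
  assert (Hh : 0 < h) by (apply Rmin_glb_lt; [generalize (cond_pos d)|]; lra).
  assert (Hh1 := Rmin_l (d / 2) x0). assert (Hh2 := Rmin_r (d / 2) x0). fold h in Hh1, Hh2.
  assert (Hq : Rabs ((u_trace D (x0 + - h) - u_trace D x0) / - h - r) < r).
  { apply Hdd; [lra|]. rewrite Rabs_Ropp, Rabs_pos_eq by lra. generalize (cond_pos d); lra. }
  apply Rabs_def2 in Hq.
  assert (Hm : u_trace D x0 <= u_trace D (x0 + - h)) by (apply Hmin; lra).
  assert (0 <= (u_trace D (x0 + - h) - u_trace D x0) / h) by (apply Rdiv_le_0_compat; lra).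
  replace ((u_trace D (x0 + - h) - u_trace D x0) / - h)
    with (- ((u_trace D (x0 + - h) - u_trace D x0) / h)) in Hq by (field; lra).
  lra. }
assert (Hs : free_surface x0 (xh, 0)) by (split; simpl; [lra|trivial]).
exists xh. split; [lra|]. split; [trivial|]. split.
- intros P HP. exists (xh, 0). split; [apply (locally_singleton _ _ HP)|trivial].
- right. intros [x y] Hq. apply closure_free_surface in Hq. simpl in *.
  destruct Hq as [Hx ->]. rewrite !(u_trace_eq D) by (trivial; lra). apply Hmin; trivial.
Qed.
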